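(* Let $h$ be the morphism on $\{a,b\}^*$ given by $h(a)=aab$, $h(b)=b$, and let $\mathbf z=h^\omega(a)=\lim_{n\to\infty}h^n(a)=aabaabbaabaabbb\cdots$ be its infinite fixed point starting with $a$. For every $n\ge 0$, $$\rho_{\mathbf z}(n)=\sum_{0\le i\le n}\min(2^i,\,n-i+1).$$
   Context: For an infinite word $\mathbf a=a_0a_1a_2\cdots$, a factor is a finite block $a_ia_{i+1}\cdots a_j$ (possibly empty). The subword complexity $\rho_{\mathbf a}(n)$ is the number of distinct factors of $\mathbf a$ of length $n$. $h^0(a)=a$ and $h^n(a)=h(h^{n-1}(a))$. *)

(* Defs.v *)
From HB Require Import structures.
From mathcomp Require Import all_boot.
From mathcomp Require Import boolp.

Set Implicit Arguments.
Unset Strict Implicit.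
Unset Printing Implicit Defensive.

Definition infword (A : Type) := nat -> A.

Definition factor (A : Type) (x : infword A) (w : seq A) : Prop :=
  exists i, w = [seq x k | k <- iota i (size w)].

Definition subword_complexity (A : finType) (x : infword A) (n : nat) : nat :=
  #|[set w : n.-tuple A | `[< factor x w >]]|.

(* The limit is meant in the usual (prefix) topology on finite and infinite
   words; the equation forces [size (u n) >= m] for n large. *)
Definition word_limit (A : Type) (u : nat -> seq A) (x : infword A) : Prop :=
  forall m, exists N, forall n, N <= n -> take m (u n) = [seq x k | k <- iota 0 m].

Inductive letter := a | b.

Definition bool_of_letter (c : letter) : bool := if c is a then true else false.
Definition letter_of_bool (t : bool) : letter := if t then a else b.
Lemma bool_of_letterK : cancel bool_of_letter letter_of_bool.
Proof. by case. Qed.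

HB.instance Definition _ := Countable.copy letter (can_type bool_of_letterK).
HB.instance Definition _ : isFinite letter := CanIsFinite bool_of_letterK.

Definition morphism (A B : Type) (f : A -> seq B) (w : seq A) : seq B :=
  flatten (map f w).

Definition h : seq letter -> seq letter :=
  morphism (fun c => match c with a => [:: a; a; b] | b => [:: b] end).

(* The limit of the words h^n(a) exists and is unique, and it is a fixed point
   of h: the h-image of each of its prefixes is again a prefix. *)

Lemma h_cat u v : h (u ++ v) = h u ++ h v.
Proof. by rewrite /h /morphism map_cat flatten_cat. Qed.

Lemma iter_h_cat n u v : iter n h (u ++ v) = iter n h u ++ iter n h v.
Proof. by elim: n => //= n ->; rewrite h_cat. Qed.

Lemma iter_h_aS n :
  iter n.+1 h [:: a] = iter n h [:: a] ++ iter n h [:: a] ++ [:: b].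
Proof.
have hb : iter n h [:: b] = [:: b] by elim: n => //= n ->.
by rewrite iterSr (_ : h [:: a] = [:: a] ++ [:: a] ++ [:: b]) // !iter_h_cat hb.
Qed.

Lemma size_iter_h_a n : n < size (iter n h [:: a]).
Proof.
elim: n => // n IH; rewrite iter_h_aS !size_cat /= addnA addn1 ltnS.
exact: leq_trans IH (leq_addr _ _).
Qed.

Lemma iter_h_a_prefix m n : m <= n ->
  prefix (iter m h [:: a]) (iter n h [:: a]).
Proof.
elim: n => [|n IH]; first by rewrite leqn0 => /eqP->; rewrite prefix_refl.
rewrite leq_eqVlt => /orP[/eqP->|]; first by rewrite prefix_refl.
by rewrite ltnS => /IH /prefix_trans; apply; rewrite iter_h_aS prefix_prefix.
Qed.

Lemma word_limit_h_ex : exists z, word_limit (fun n => iter n h [:: a]) z.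
Proof.
exists (fun k => nth a (iter k h [:: a]) k) => m; exists m => n le_mn.
have lt_m : m < size (iter n h [:: a]) by exact: leq_ltn_trans (size_iter_h_a n).
apply: (@eq_from_nth _ a); first by rewrite size_takel ?(ltnW lt_m) // size_map size_iota.
rewrite size_takel ?(ltnW lt_m) // => k lt_km.
rewrite nth_take // (nth_map 0) ?size_iota // nth_iota // add0n.
have /prefixP[s ->] := iter_h_a_prefix (leq_trans (ltnW lt_km) le_mn).
by rewrite nth_cat size_iter_h_a.
Qed.

Lemma word_limit_unique (A : Type) (u : nat -> seq A) (x y : infword A) :
  word_limit u x -> word_limit u y -> x = y.
Proof.
move=> ux uy; apply/funext => k.
have [[N1 H1] [N2 H2]] := (ux k.+1, uy k.+1).
have := H1 _ (leq_maxl N1 N2); rewrite (H2 _ (leq_maxr N1 N2)).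
move=> /(congr1 (fun s => nth (x k) s k)).
by rewrite !(nth_map 0) ?size_iota // !nth_iota.
Qed.

Lemma word_limit_h_fixed z : word_limit (fun n => iter n h [:: a]) z ->
  z 0 = a /\ forall m, let w := h [seq z k | k <- iota 0 m] in
    w = [seq z k | k <- iota 0 (size w)].
Proof.
move=> zP; split.
  have [N /(_ N.+1 (leqnSn N))] := zP 1.
  by have /prefixP[s ->] := iter_h_a_prefix (leq0n N.+1) => -[->].
move=> m w; have [[N1 H1] [N2 H2]] := (zP m, zP (size w)).
rewrite -(H2 (maxn N1 N2).+1) ?(leq_trans (leq_maxr N1 N2)) //=.
rewrite -[iter _ _ _](cat_take_drop m) h_cat (H1 _ (leq_maxl _ _)).
by rewrite take_size_cat.
Qed.

(* Main.v *)
Require Import Defs.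
From mathcomp Require Import all_boot.
From mathcomp Require Import boolp zify.

Set Implicit Arguments.
Unset Strict Implicit.
Unset Printing Implicit Defensive.

(** A letter is always available to the right of a factor, so
    [rho (n+1) - rho n] is the number of right special factors of length [n],
    the words [w] such that [wa] and [wb] are both factors.  Every block [h c]
    ends with its only [b], hence [h] is decoded by cutting after each [b];
    two distinct letters have images whose longest common suffix is [b], so a
    word right special in [h^(N+1)(a)] is empty, [a], or a suffix of [b h(y)]
    for some [y] right special in [h^N(a)].  Therefore the right special
    factors are the suffixes of the words [b^j h^j(a)], which have length
    [2^(j+1) + j - 1] and end with [a b^j]: there is one of length [n] for each
    [j <= n] with [n <= 2^(j+1) + j - 1]. *)

(** * Decoding of [h] and common suffixes of images *)

Lemma h_cons c w : h (c :: w) = h [:: c] ++ h w.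
Proof. by rewrite -cat1s h_cat. Qed.

Lemma h_nseq_b n : h (nseq n b) = nseq n b.
Proof. by elim: n => //= n IH; rewrite h_cons IH. Qed.

Lemma h_cut_b x p q : h x = rcons p b ++ q ->
  exists x1 x2, [/\ x = x1 ++ x2, h x1 = rcons p b & h x2 = q].
Proof.
elim: x p => [|c x IH] p; first by case: p.
rewrite h_cons; case: c => /=.
- case: p => [|c1 [|c2 [|c3 p]]] //= [].
    by move=> <- <- <-; exists [:: a], x.
  move=> <- <- <- /IH [x1 [x2 [-> h1 h2]]].
  by exists (a :: x1), x2; split=> //; rewrite h_cons h1.
- case: p => [|c1 p] /= [].
    by move=> <-; exists [:: b], x.
  move=> <- /IH [x1 [x2 [-> h1 h2]]].
  by exists (b :: x1), x2; split=> //; rewrite h_cons h1.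
Qed.

Lemma h_neq_ab x q : h x <> a :: b :: q.
Proof. by case: x => [|[] x] //; rewrite h_cons. Qed.

Lemma h_head x c q : h x = c :: q -> exists x', x = c :: x'.
Proof. by case: x => [|[] x] //; rewrite h_cons /= => -[<- _]; exists x. Qed.

Lemma h_no_aaa x p q : h x <> p ++ a :: a :: a :: q.
Proof.
elim: x p => [|c x IH] p; first by case: p.
rewrite h_cons; case: c => /=.
- by case: p => [|c1 [|c2 [|c3 p]]] //= [] _ _ _ /IH.
- by case: p => [|c1 p] //= [] _ /IH.
Qed.

Lemma h_no_bab x p q : h x <> p ++ b :: a :: b :: q.
Proof. by rewrite -cat_rcons => /h_cut_b [x1 [x2 [_ _]]] /h_neq_ab. Qed.

Lemma h_rcons_a x : h (rcons x a) = rcons (rcons (rcons (h x) a) a) b.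
Proof. by rewrite -!cats1 h_cat -!catA. Qed.

Lemma h_rcons_b x : h (rcons x b) = rcons (h x) b.
Proof. by rewrite -!cats1 h_cat. Qed.

Lemma suffix_h_rcons_a x w : suffix (rcons w a) (h x) = false.
Proof.
case/lastP: x => [|x []]; last by rewrite h_rcons_b suffix_rcons.
  by rewrite suffixs0 -size_eq0 size_rcons.
by rewrite h_rcons_a suffix_rcons.
Qed.

Lemma suffix_rconsE (T : eqType) (w s : seq T) c : suffix w (rcons s c) ->
  w = [::] \/ exists2 w', w = rcons w' c & suffix w' s.
Proof.
case/lastP: w => [|w d]; first by left.
by rewrite suffix_rcons => /andP[/eqP-> ws]; right; exists w.
Qed.

(** Equal last letters of [x] and [y] go into [s] and their block is stripped from [w]. At the first
    mismatch the blocks [aab] and [b] share only the leading [b] of [b :: h s]. *)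
Lemma common_suffix_h x y w : suffix w (h x) -> suffix w (h y) ->
  exists s, [/\ suffix s x, suffix s y & suffix w (b :: h s)].
Proof.
have nilP u v : exists s, [/\ suffix s u, suffix s v & suffix [::] (b :: h s)].
  by exists [::]; rewrite !suffix0s.
(* Before the final [b], the first image has an [a], whereas [h v] never ends with [a]. *)
have mixed u v w' : suffix w' (h (rcons u a)) -> suffix w' (h (rcons v b)) ->
    suffix w' [:: b].
  rewrite h_rcons_a h_rcons_b => /suffix_rconsE[->|]; first by rewrite suffix0s.
  move=> [{}w' -> /suffix_rconsE[->|[{}w' -> _]]]; first by [].
  by rewrite suffix_rcons suffix_h_rcons_a andbF.
elim/last_ind: x y w => [|x c IH] y w.
  by rewrite /= suffixs0 => /eqP-> _; apply: nilP.
case/lastP: y => [|y d]; first by move=> _; rewrite suffixs0 => /eqP->.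
case: c d => [] []; last 1 first.
- rewrite !h_rcons_b => /suffix_rconsE[-> //|[{}w -> wx]].
  rewrite suffix_rcons /= => /(IH _ _ wx) [s [sx sy ws]]; exists (rcons s b).
  by rewrite h_rcons_b -rcons_cons !suffix_rcons sx sy ws.
- rewrite !h_rcons_a => /suffix_rconsE[-> //|[{}w -> wx]].
  rewrite suffix_rcons /= => wy.
  suff [s [sx sy ws]] : exists s, [/\ suffix s x, suffix s y &
      suffix w (rcons (rcons (b :: h s) a) a)].
    exists (rcons s a).
    by rewrite h_rcons_a -!rcons_cons !suffix_rcons /= sx sy; split.
  move: wx wy => /suffix_rconsE[-> _|]; first by exists [::]; rewrite !suffix0s.
  move=> [{}w -> wx]; rewrite suffix_rcons /= => wy.
  move: wx wy => /suffix_rconsE[-> _|].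
    by exists [::]; rewrite !suffix0s.
  move=> [{}w -> wx]; rewrite suffix_rcons /= => /(IH _ _ wx) [s [sx sy ws]].
  by exists s; rewrite -!rcons_cons !suffix_rcons.
- by move=> wx wy; exists [::]; rewrite !suffix0s (mixed _ _ _ wx wy).
- by move=> wx wy; exists [::]; rewrite !suffix0s (mixed _ _ _ wy wx).
Qed.

(** * Right special words in the iterates of [h] *)

Definition maxspecial j := nseq j b ++ iter j h [:: a].

Lemma maxspecialS j : maxspecial j.+1 = b :: h (maxspecial j).
Proof. by rewrite /maxspecial h_cat h_nseq_b. Qed.

Lemma size_maxspecial j : (size (maxspecial j)).+1 = 2 ^ j.+1 + j.
Proof.
suff sz : (size (iter j h [:: a])).+1 = 2 ^ j.+1.
  by rewrite size_cat size_nseq -addnS sz addnC.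
by elim: j => // j IH; rewrite iter_h_aS !size_cat /= expnS; lia.
Qed.

Lemma suffix_maxspecial j : suffix (a :: nseq j b) (maxspecial j).
Proof.
suff /suffix_trans: suffix (a :: nseq j b) (iter j h [:: a]).
  by apply; apply: suffix_suffix.
elim: j => // j /suffixP[s]; rewrite iterS => ->.
apply/suffixP; exists (h s ++ [:: a]).
by rewrite h_cat h_cons h_nseq_b -[RHS]catA.
Qed.

(** A right special word longer than [a] cannot end with [a], since [aaa] or [bab] would occur. If
    it ends with [b], both occurrences are decoded and [common_suffix_h] yields a right special word
    one level down. *)
Lemma right_special_suffix N w :
  infix (rcons w a) (iter N h [:: a]) -> infix (rcons w b) (iter N h [:: a]) ->
  exists j, suffix w (maxspecial j).
Proof.
elim: N w => [|N IH] w.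
  by case: w => [|c [|d w]] // _ /infixP [[|e [|f p]] [q]].
rewrite iterS; set x := iter N h _ => /infixP[p [q hx]] /infixP[p' [q' hx']].
case/lastP: w hx hx' => [|w []] hx hx'; first by exists 0; apply: suffix0s.
- case/lastP: w hx hx' => [|w []] hx hx'; first by exists 0.
  + by case: (@h_no_aaa x (p ++ w) q); rewrite hx -!cats1 -!catA.
  + by case: (@h_no_bab x (p' ++ w) q'); rewrite hx' -!cats1 -!catA.
(* After the cut, [c] starts a block, and the block of a letter starts with that letter: the
   preimage continues with [c] too. *)
have cut c r s : h x = r ++ rcons (rcons w b) c ++ s ->
    exists x1 x2, x = x1 ++ c :: x2 /\ suffix (rcons w b) (h x1).
  rewrite cat_rcons catA -rcons_cat => /h_cut_b[x1 [x2 [xE h1]]].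
  move=> /h_head[x3 x2E]; exists x1, x3; rewrite xE x2E h1; split=> //.
  by rewrite rcons_cat suffix_suffix.
have [x1 [x2 [xE w1]]] := cut _ _ _ hx.
have [y1 [y2 [yE w2]]] := cut _ _ _ hx'.
have [s [/suffixP[u x1E] /suffixP[v y1E] ws]] := common_suffix_h w1 w2.
have [||j sj] := IH s.
- by apply/infixP; exists u, x2; rewrite -/x xE x1E cat_rcons catA.
- by apply/infixP; exists v, y2; rewrite -/x yE y1E cat_rcons catA.
exists j.+1; apply: (suffix_trans ws); rewrite maxspecialS.
(* The [b] before [h s] ends the last block of [h t], or is the leading [b] when [t] is empty. *)
case/suffixP: sj => t ->; rewrite h_cat.
case/lastP: t => [|t []]; first exact: suffix_refl.
  by rewrite h_rcons_a -cat_cons -rcons_cons cat_rcons suffix_suffix.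
by rewrite h_rcons_b -cat_cons -rcons_cons cat_rcons suffix_suffix.
Qed.

(** In $h^{N+1}(a)=h^N(a)h^N(a)b$, an occurrence inside the second copy has a letter on its left. *)
Lemma infix_iter_h_extend_left N w : infix w (iter N h [:: a]) ->
  exists c, infix (c :: w) (iter N.+1 h [:: a]).
Proof.
move=> /infixP[p [q wE]].
case/lastP xE: (iter N h [:: a] ++ p) => [|u c].
  by have := size_iter_h_a N; move: xE; case: (iter N h _).
exists c; apply/infixP; exists u, (q ++ [:: b]).
by rewrite iter_h_aS [X in _ ++ X ++ _]wE cat_cons -(cat_rcons c) -xE -!catA.
Qed.

Lemma cat_infixl (T : eqType) (u v s : seq T) : infix (u ++ v) s -> infix u s.
Proof.
by case/infixP=> p [q ->]; apply/infixP; exists p, (v ++ q); rewrite -catA.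
Qed.

Lemma cat_infixr (T : eqType) (u v s : seq T) : infix (u ++ v) s -> infix v s.
Proof.
by case/infixP=> p [q ->]; apply/infixP; exists (p ++ u), q; rewrite -!catA.
Qed.

Lemma infix_h u v : infix u v -> infix (h u) (h v).
Proof.
by case/infixP=> p [q ->]; rewrite !h_cat; apply/infixP; exists (h p), (h q).
Qed.

(** Extend [maxspecial j] followed by [c] to the left by some [d], then apply [h]: [h [:: d]] ends
    with the required [b], and [h [:: c]] starts with [c]. *)
Lemma maxspecial_extend j c :
  exists N, infix (rcons (maxspecial j) c) (iter N h [:: a]).
Proof.
elim: j => [|j [N /infix_iter_h_extend_left[d]]]; first by exists 1; case: c.
move=> /infix_h; rewrite -iterS => wN; exists N.+2; move: wN.
rewrite maxspecialS h_cons -cats1 h_cat => wN.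
have {}wN : infix ([:: b] ++ h (maxspecial j) ++ h [:: c]) (iter N.+2 h [:: a]).
  by case: d wN => // wN; apply: (@cat_infixr _ [:: a; a]).
have [t ct] : exists t, h [:: c] = c :: t by case: (c); eexists.
apply: (@cat_infixl _ _ t).
by move: wN; rewrite ct cat_rcons.
Qed.

Lemma infix_iter_hW m n w : m <= n ->
  infix w (iter m h [:: a]) -> infix w (iter n h [:: a]).
Proof. by move=> /iter_h_a_prefix/prefixW mn /infix_trans; apply. Qed.

(** * From iterates to the infinite word, and the complexity increment *)

Lemma factor_infixP (z : infword letter)
    (hz : word_limit (fun n => iter n h [:: a]) z) w :
  factor z w <-> exists N, infix w (iter N h [:: a]).
Proof.
split=> [[i wE]|[N /infixP[p [q wE]]]].
  have [N /(_ N (leqnn N)) NE] := hz (i + size w).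
  exists N; rewrite -[iter N h _](cat_take_drop (i + size w)) NE.
  by apply/infixP; eexists _, _; rewrite iotaD map_cat -wE -catA.
have [M /(_ _ (leq_maxr N M))] := hz (size (iter N h [:: a])).
have /prefixP[s ->] := iter_h_a_prefix (leq_maxl N M).
rewrite take_size_cat // => NE; exists (size p).
have -> : w = take (size w) (drop (size p) (iter N h [:: a])).
  by rewrite wE drop_size_cat // take_size_cat.
rewrite NE -map_drop -map_take drop_iota take_iota size_map size_iota.
by congr map.
Qed.

Lemma factor_extend (z : infword letter) w :
  factor z w -> factor z (rcons w a) \/ factor z (rcons w b).
Proof.
move=> [i wE].
have : factor z (rcons w (z (i + size w))).
  by exists i; rewrite size_rcons -addn1 iotaD map_cat -wE -cats1.
by case: (z _); [left|right].
Qed.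

Lemma factor_rcons (T : Type) (x : infword T) w c :
  factor x (rcons w c) -> factor x w.
Proof.
move=> [i]; rewrite size_rcons -addn1 iotaD map_cat cats1 => /rcons_inj[wE _].
by exists i.
Qed.

Lemma right_specialP (z : infword letter)
    (hz : word_limit (fun n => iter n h [:: a]) z) w :
  (factor z (rcons w a) /\ factor z (rcons w b)) <->
  exists j, suffix w (maxspecial j).
Proof.
rewrite !(factor_infixP hz); split=> [[[N wN] [M wM]]|[j /suffixP[t jE]]].
  apply: (@right_special_suffix (maxn N M)).
    exact: infix_iter_hW (leq_maxl _ _) wN.
  exact: infix_iter_hW (leq_maxr _ _) wM.
split.
  have [N wN] := maxspecial_extend j a; exists N; move: wN.
  by rewrite jE rcons_cat; apply: cat_infixr.
have [N wN] := maxspecial_extend j b; exists N; move: wN.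
by rewrite jE rcons_cat; apply: cat_infixr.
Qed.

Definition right_special_set n :=
  [set w : n.-tuple letter | `[< exists j, suffix w (maxspecial j) >]].

(** With [A c] the words that [c] can follow, $|A_a\cup A_b|+|A_a\cap A_b|=|A_a|+|A_b|$, and the
    right side counts factors of length $n+1$ by last letter. *)
Lemma subword_complexityS (z : infword letter)
    (hz : word_limit (fun n => iter n h [:: a]) z) n :
  subword_complexity z n.+1 = subword_complexity z n + #|right_special_set n|.
Proof.
pose A c := [set w : n.-tuple letter | `[< factor z (rcons w c) >]].
pose f c (w : n.-tuple letter) := [tuple of rcons w c].
have f_inj c : injective (f c).
  by move=> u v /(congr1 val) /= /rcons_inj[uv]; apply: val_inj.
have -> : right_special_set n = A a :&: A b.
  apply/setP=> w; rewrite !inE -asbool_and; apply: asbool_equiv_eq.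
  by apply: iff_sym; apply: right_specialP hz _.
have -> : subword_complexity z n = #|A a :|: A b|.
  apply: eq_card => w; rewrite !inE -asbool_or; apply: asbool_equiv_eq.
  by split=> [/factor_extend //|[]]; apply: factor_rcons.
rewrite cardsUI -(card_imset _ (f_inj a)) -(card_imset _ (f_inj b)) -cardsUI.
have -> : f a @: A a :&: f b @: A b = set0.
  apply/setP=> w; rewrite !inE; apply/negP=> /andP[/imsetP[u _ ->] /imsetP[v _]].
  by move=> /(congr1 val) /= /rcons_inj[].
rewrite cards0 addn0; apply: eq_card => w; rewrite !inE.
apply/asboolP/orP => [|[/imsetP[u]|/imsetP[u]]]; last 2 first.
- by rewrite inE => /asboolP ? ->.
- by rewrite inE => /asboolP ? ->.
have [c [u ->]] : exists c u, w = f c u.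
  case: w => s; case/lastP: s => [//|s c] sz.
  have szs : size s == n by move: sz; rewrite size_rcons.
  by exists c, (Tuple szs); apply: val_inj.
by case: c => fw; [left|right]; apply: imset_f; rewrite inE; apply/asboolP.
Qed.

(** * Counting right special words of a given length *)

Lemma suffix_total (T : eqType) (u v s : seq T) :
  suffix u s -> suffix v s -> size u <= size v -> suffix u v.
Proof.
move=> us vs uv; have vsz := size_suffix vs.
move: us vs; rewrite !suffixE => /eqP us /eqP vs.
rewrite -{2}vs drop_drop (_ : _ + _ = size s - size u) ?us //; lia.
Qed.

(** The summand tests whether [maxspecial j] has length at least [n]. Indices $j\ge n$ all give
    $b^n$, so $j=n$ represents them. *)
Lemma card_right_special_set n :
  #|right_special_set n| = \sum_(j < n.+1) (n < 2 ^ j.+1 + j).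
Proof.
pose R j := drop (size (maxspecial j) - n) (maxspecial j).
pose f (j : 'I_n.+1) : n.-tuple letter := insubd (nseq_tuple n b) (R j).
have RE j : n < 2 ^ j.+1 + j -> size (R j) = n.
  by rewrite -size_maxspecial ltnS size_drop => /subKn.
have fE (j : 'I_n.+1) : n < 2 ^ j.+1 + j -> val (f j) = R j.
  by move=> /RE sz; rewrite val_insubd sz eqxx.
have nle j : n <= j -> n < 2 ^ j.+1 + j.
  by move=> nj; rewrite -[n]add0n -addSn leq_add // expn_gt0.
have Rb j : n <= j -> R j = nseq n b.
  move=> nj; have /suffixP[s sE] := suffix_maxspecial j.
  have : suffix (nseq n b) (maxspecial j).
    apply/suffixP; exists (s ++ a :: nseq (j - n) b).
    by rewrite sE -[RHS]catA cat_cons -nseqD subnK.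
  by rewrite suffixE size_nseq => /eqP.
transitivity #|f @: [set j : 'I_n.+1 | n < 2 ^ j.+1 + j]|.
  apply: eq_card => w; rewrite !inE; apply/asboolP/imsetP.
    move=> [j wj].
    have nj : n < 2 ^ j.+1 + j.
      by rewrite -size_maxspecial ltnS -{1}(size_tuple w) size_suffix.
    have wE : val w = R j by move: wj; rewrite suffixE size_tuple => /eqP.
    have [jn|jn] := leqP j n.
      exists (Ordinal (jn : j < n.+1)); first by rewrite inE.
      by apply: val_inj; rewrite fE.
    exists ord_max; first by rewrite inE nle.
    by apply: val_inj; rewrite fE ?nle //= wE !Rb // ltnW.
  move=> [j]; rewrite inE => nj ->; exists j; rewrite fE //.
  exact: suffix_drop.
rewrite card_in_imset; last first.
  (* The last $j+1$ letters are $ab^j$ in [R j] but $b^{j+1}$ in [R k]. *)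
  have neq j k : j < k <= n -> n < 2 ^ j.+1 + j -> n < 2 ^ k.+1 + k -> R j != R k.
    move=> /andP[jk kn] nj nk; apply/negP => /eqP jkE.
    have sa : suffix (a :: nseq j b) (R j).
      apply: suffix_total (suffix_maxspecial j) (suffix_drop _ _) _.
      by rewrite RE //= size_nseq (leq_trans jk).
    have sb : suffix (nseq j.+1 b) (R j).
      rewrite jkE; apply: suffix_total (suffix_drop _ _) _.
        have /suffixP[s ->] := suffix_maxspecial k.
        apply/suffixP; exists (s ++ a :: nseq (k - j.+1) b).
        by rewrite -[RHS]catA cat_cons -nseqD subnK.
      by rewrite RE // size_nseq (leq_trans jk).
    have := suffix_total sa sb; rewrite /= size_nseq leqnn => /(_ isT).
    by rewrite suffixE /= size_nseq subnn drop0.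
  move=> j k; rewrite !inE => nj nk /(congr1 val); rewrite !fE // => jkE.
  apply: val_inj; case: (ltngtP j k) => // lt.
    by have := @neq j k; rewrite lt -ltnS ltn_ord jkE eqxx => /(_ isT nj nk).
  by have := @neq k j; rewrite lt -ltnS ltn_ord jkE eqxx => /(_ isT nk nj).
by rewrite cardsE -sum1_card big_mkcond.
Qed.

Theorem theorem1 (z : infword letter)
  (hz : word_limit (fun n => iter n h [:: a]) z) (n : nat) :
  subword_complexity z n = \sum_(0 <= i < n.+1) minn (2 ^ i) (n - i + 1).
Proof.
elim: n => [|n IH].
  rewrite big_nat1 /subword_complexity /=.
  rewrite (_ : [set _ | _] = [set: 0.-tuple letter]) ?cardsT ?card_tuple //.
  by apply/setP=> w; rewrite !inE (tuple0 w); apply/asboolP; exists 0.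
rewrite subword_complexityS // IH card_right_special_set.
rewrite [in RHS]big_nat_recr //= subnn.
(* Passing from $n$ to $n+1$ raises $\min(2^i,n-i+1)$ by one exactly when $n-i+1<2^i$. *)
rewrite [in RHS](eq_big_nat _ _
  (F2 := fun i => minn (2 ^ i) (n - i + 1) + (n.+1 < 2 ^ i + i))); last first.
  by move=> i /andP[_ ilt]; move: (2 ^ i) => m; case: ltnP; lia.
rewrite big_split /= -!addnA; congr (_ + _).
(* The new term $i=n+1$ equals 1, hence fits the same indicator. *)
rewrite (_ : minn _ _ = (n.+1 < 2 ^ n.+1 + n.+1)); last first.
  have := expn_gt0 2 n.+1; lia.
rewrite -(big_nat_recr _ _ (fun i => (n.+1 < 2 ^ i + i) : nat)) //=.
(* The indicator at $i=0$ vanishes; the shift $i=j+1$ matches the count. *)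
rewrite big_nat_recl //= add0n big_mkord.
by apply: eq_bigr => i _; rewrite addnS.
Qed.
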